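(* Let $S$ be an atomic monoid. (1) For every $u \in \mathcal A (S_{\mathrm{red}})$ we have \[ \mathsf t (S, u) \le \sup \{ |x|, |y| \mid (x,y) \in \mathcal A (\sim_S), \ x \in u\, \mathsf Z (S) \} . \] (2) $\mathsf t (S) \le \mathsf a (S)$. (3) If $\mathsf a (S) < \infty$, then $\mathsf c_{\mathrm{adj}} (S) < \infty$.
   Context: $\mathbb N$ denotes the positive integers, $\mathbb N_0=\mathbb N\cup\{0\}$; suprema are taken in $\mathbb N_0\cup\{\infty\}$ (with $\sup\emptyset=0$). A monoid is a commutative, cancellative semigroup with unit element. $\mathcal A(S)$ is the set of atoms, $S_{\mathrm{red}}=\{aS^\times\mid a\in S\}$ the associated reduced monoid. $\mathsf Z(S)=\mathcal F(\mathcal A(S_{\mathrm{red}}))$ is the free abelian monoid with basis $\mathcal A(S_{\mathrm{red}})$, $|z|$ the length of $z\in\mathsf Z(S)$, $\pi\colon\mathsf Z(S)\to S_{\mathrm{red}}$ the homomorphism with $\pi(u)=u$ for $u\in\mathcal A(S_{\mathrm{red}})$. For $a\in S$: $\mathsf Z(a)=\{z\mid\pi(z)=aS^\times\}$ and $\mathsf L(a)=\{|z|\mid z\in\mathsf Z(a)\}$. $S$ is atomic if $\mathsf Z(a)\ne\emptyset$ for all $a\in S$. The monoid of relations is $\sim_S\,=\{(x,y)\in\mathsf Z(S)\times\mathsf Z(S)\mid\pi(x)=\pi(y)\}$, a (reduced, atomic) submonoid of $\mathsf Z(S)\times\mathsf Z(S)$, and $\mathcal A(\sim_S)$ is its set of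 atoms. Put \[\mathsf a(S)=\sup\{|x|\mid(x,y)\in\mathcal A(\sim_S)\text{ for some }y\in\mathsf Z(S)\}.\] The distance of $z,z'\in\mathsf Z(S)$ is $\mathsf d(z,z')=\max\{|z\gcd(z,z')^{-1}|,|z'\gcd(z,z')^{-1}|\}$; for nonempty $X,Y\subset\mathsf Z(S)$, $\mathsf d(X,Y)=\min\{\mathsf d(x,y)\mid x\in X,y\in Y\}$. Tame degree: for $a\in S$ and $x\in\mathsf Z(S)$, $\mathsf t(a,x)$ is the smallest $N\in\mathbb N_0\cup\{\infty\}$ such that: if $\mathsf Z(a)\cap x\mathsf Z(S)\ne\emptyset$ and $z\in\mathsf Z(a)$, then there is $z'\in\mathsf Z(a)\cap x\mathsf Z(S)$ with $\mathsf d(z,z')\le N$. Put $\mathsf t(S,x)=\sup\{\mathsf t(a,x)\mid a\in S\}$ and $\mathsf t(S)=\sup\{\mathsf t(S,u)\mid u\in\mathcal A(S_{\mathrm{red}})\}$. Two distinct elements $k,l$ of a set $L\subset\mathbb Z$ are adjacent if $L$ contains no integer strictly between them. With $\mathsf Z_k(a)=\{z\in\mathsf Z(a)\mid|z|=k\}$, put $\mathsf c_{\mathrm{adj}}(a)=\sup\{\mathsf d(\mathsf Z_k(a),\mathsf Z_l(a))\mid k,l\in\mathsf L(a)\text{ adjacent}\}$ and $\mathsf c_{\mathrm{adj}}(S)=\sup\{\mathsf c_{\mathrm{adj}}(a)\mid a\in S\}$. *)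

(* Defs.v *)
From HB Require Import structures.
From mathcomp Require Import all_boot all_order finmap multiset.
From mathcomp Require Import boolp classical_sets.

Set Implicit Arguments.
Unset Strict Implicit.
Unset Printing Implicit Defensive.

Import Order.TTheory.

(* Infix notations shared by [multiset] and [classical_sets] denote the set
   operations, unless delimited by [%mset]. *)
Local Open Scope mset_scope.
Local Open Scope group_scope.
Local Open Scope classical_set_scope.

Inductive enat := Fin of nat | Infty.

Definition enat_opt (x : enat) : option nat :=
  if x is Fin n then Some n else None.
Definition opt_enat (x : option nat) : enat :=
  if x is Some n then Fin n else Infty.
Lemma enat_optK : cancel enat_opt opt_enat. Proof. by case. Qed.

HB.instance Definition _ := Choice.copy enat (can_type enat_optK).

Definition enat_le (x y : enat) : bool :=
  match x, y with
  | _, Infty => true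
  | Infty, Fin _ => false
  | Fin m, Fin n => (m <= n)%N
  end.

Lemma enat_le_refl : reflexive enat_le. Proof. by case=> /=. Qed.
Lemma enat_le_anti : antisymmetric enat_le.
Proof.
by case=> [m|] [n|] //= /anti_leq ->.
Qed.
Lemma enat_le_trans : transitive enat_le.
Proof. by case=> [m|] [n|] [p|] //=; apply: leq_trans. Qed.
Lemma enat_le_total : total enat_le.
Proof. by case=> [m|] [n|] //=; apply: leq_total. Qed.

Fact enat_display : Order.disp_t. Proof. exact: Order.Disp tt tt. Qed.

HB.instance Definition _ := Order.Le_isPOrder.Build enat_display enat
  enat_le_refl enat_le_anti enat_le_trans.
HB.instance Definition _ :=
  Order.POrder_isTotal.Build enat_display enat enat_le_total.

Lemma lee_fin m n : (Fin m <= Fin n)%O = (m <= n)%N. Proof. by []. Qed.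
Lemma leeInfty x : (x <= Infty)%O. Proof. by case: x. Qed.
Lemma le0e x : (Fin 0 <= x)%O. Proof. by case: x. Qed.
Lemma lteInfty x : (x < Infty)%O <-> exists n, x = Fin n.
Proof.
split=> [|[n ->] //]; first by case: x => [n|] //; exists n.
Qed.

(** [esup set0 = 0] and [einf set0 = Infty]; the infimum of a nonempty set is
    its minimum, see [einf_least]. *)
Definition esup (E : set enat) : enat := supremum (Fin 0) E.
Definition einf (E : set enat) : enat := infimum Infty E.

Lemma enat_least (E : set enat) : E !=set0 -> exists2 m, E m & lbound E m.
Proof.
move=> [x Ex].
have [[n En]|nE] := pselect (exists n, E (Fin n)).
  have exE : exists n, `[< E (Fin n) >] by exists n; apply/asboolP.
  exists (Fin (ex_minn exE)); case: ex_minnP => m /asboolP Em mP //.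
  by case=> [k|] // Ek; rewrite lee_fin mP //; apply/asboolP.
have Einf y : E y -> y = Infty by case: y => // n En; case: nE; exists n.
by exists x => // y Ey; rewrite (Einf x) // (Einf y).
Qed.

Lemma einf_least (E : set enat) : E !=set0 -> E (einf E) /\ lbound E (einf E).
Proof.
move=> E0; have [m Em mE] := enat_least E0.
rewrite /einf /infimum; case: ifPn => [/eqP E00|_].
  by move: Em; rewrite E00.
case: xgetP => [y _ [yE yP]|/(_ m) []]; last by split=> // y; apply.
suff -> : y = m by split.
by apply/eqP; rewrite eq_le yE //= yP.
Qed.

Lemma esup_supremums (E : set enat) : E !=set0 -> supremums E (esup E).
Proof.
move=> E0; have [|m Em mE] := @enat_least (ubound E).
  by exists Infty => x _; apply: leeInfty.
rewrite /esup /supremum; case: ifPn => [/eqP E00|_].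
  by case: E0 => x; rewrite E00.
by case: xgetP => [y _ //|/(_ m) []]; split.
Qed.

Lemma esup0 : esup set0 = Fin 0. Proof. by rewrite /esup /supremum eqxx. Qed.

Lemma esup_ubound (E : set enat) : ubound E (esup E).
Proof. by move=> x Ex; have [+ _] := esup_supremums (ex_intro _ x Ex); apply. Qed.

Lemma esup_le (E : set enat) m : ubound E m -> (esup E <= m)%O.
Proof.
move=> Em; have [->|/set0P/esup_supremums[_]] := eqVneq E set0.
  by rewrite esup0 le0e.
exact.
Qed.

HB.mixin Record Monoid_isCancelComMonoid M of Monoid M := {
  mulgC : commutative (@mul M);
  mulgI : right_injective (@mul M)
}.

#[short(type="ccmonoidType")]
HB.structure Definition CancelComMonoid :=
  {M of Monoid M & Monoid_isCancelComMonoid M}.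

Bind Scope group_scope with CancelComMonoid.sort.

HB.instance Definition _ (M : ccmonoidType) :=
  SemiGroup.isCommutativeLaw.Build M mul (@mulgC M).

Section Pair.
Variables M N : ccmonoidType.

Lemma pair_mulgC : commutative (@mul (M * N)%type).
Proof. by move=> x y; congr pair; apply: mulgC. Qed.
Lemma pair_mulgI : right_injective (@mul (M * N)%type).
Proof. by move=> [x x'] [y y'] [z z'] [/mulgI -> /mulgI ->]. Qed.

HB.instance Definition _ := Monoid_isCancelComMonoid.Build (M * N)%type
  pair_mulgC pair_mulgI.
End Pair.

(** The free abelian monoid with basis [K], written multiplicatively, is the
    monoid of finite multisets of elements of [K]. *)
Section Free.
Variable K : choiceType.

Lemma msetD_inj : right_injective (@msetD K).
Proof. by move=> A; apply: can_inj (@msetDKB K A). Qed.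

HB.instance Definition _ :=
  Choice.copy {mset K} {fsfun K -> nat with 0%N}.
HB.instance Definition _ := isMonoid.Build {mset K}
  (@msetDA K) (@mset0D K) (@msetD0 K).
HB.instance Definition _ := Monoid_isCancelComMonoid.Build {mset K}
  (@msetDC K) msetD_inj.
End Free.

Section Arithmetic.
Variable M : ccmonoidType.
Implicit Types a b : M.

Definition units : set M := [set e | exists f, e * f = 1].

Definition atoms : set M :=
  [set u | ~ units u /\ forall a b, u = a * b -> units a \/ units b].

Definition aunits a : set M := [set a * e | e in units].

Lemma units1 : units 1. Proof. by exists 1; rewrite mulg1. Qed.

Lemma unitsM a b : units a -> units b -> units (a * b).
Proof.
move=> [a' aa'] [b' bb']; exists (a' * b').
by rewrite mulgA -(mulgA a) (mulgC b) mulgA aa' mul1g.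
Qed.

Lemma aunits_id a : aunits a a.
Proof. by exists 1; rewrite ?mulg1 //; apply: units1. Qed.

Lemma aunitsP a b : aunits a = aunits b <-> exists2 e, units e & b = a * e.
Proof.
split=> [eq_ab|[e ue ->]].
  have [e ue <-] : aunits a b by rewrite eq_ab; apply: aunits_id.
  by exists e.
apply/seteqP; split=> _ [f uf <-]; last first.
  by exists (e * f); [apply: unitsM|rewrite mulgA].
have [e' ee'] := ue.
exists (e' * f); last by rewrite -mulgA (mulgA e) ee' mul1g.
by apply: unitsM => //; exists e; rewrite mulgC.
Qed.

(** The elements of [red] are the cosets [a S^*] themselves, multiplied as sets;
    cf. [set_mul_aunits]. *)
Definition red : Type := range aunits.

HB.instance Definition _ := Choice.on red.

Definition to_red a : red := exist _ (aunits a) (mem_set (imageT aunits a)).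

Lemma to_red_surj (A : red) : exists a, A = to_red a.
Proof.
case: A => A mA; have [a _ Aa] := set_mem mA.
by exists a; apply: val_inj.
Qed.

Lemma to_redP a b : to_red a = to_red b <-> exists2 e, units e & b = a * e.
Proof.
rewrite -aunitsP; split=> [/(congr1 val)//|eq_ab].
exact: val_inj.
Qed.

Definition set_mul (A B : set M) : set M := [set a * b | a in A & b in B].

Lemma set_mul_aunits a b : set_mul (aunits a) (aunits b) = aunits (a * b).
Proof.
apply/seteqP; split=> [_ [_ [e ue <-] [_ [f uf <-] <-]]|_ [e ue <-]].
  exists (e * f); first exact: unitsM.
  by rewrite !mulgA; congr (_ * _); rewrite -!mulgA; congr (_ * _); apply: mulgC.
exists a; first exact: aunits_id.
by exists (b * e); [exists e|rewrite mulgA].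
Qed.

Lemma red_mul_subproof (A B : red) : set_mul (val A) (val B) \in range aunits.
Proof.
have [[a ->] [b ->]] := (to_red_surj A, to_red_surj B).
by rewrite /= set_mul_aunits; apply/mem_set/imageT.
Qed.

Definition red_mul (A B : red) : red := exist _ (set_mul (val A) (val B)) (red_mul_subproof A B).

Lemma to_redM a b : to_red (a * b) = red_mul (to_red a) (to_red b).
Proof. by apply: val_inj; rewrite /= set_mul_aunits. Qed.

Lemma red_mulC : commutative red_mul.
Proof.
move=> A B; have [[a ->] [b ->]] := (to_red_surj A, to_red_surj B).
by rewrite -!to_redM mulgC.
Qed.

Lemma red_mulA : associative red_mul.
Proof.
move=> A B C; have [[a ->] [b ->]] := (to_red_surj A, to_red_surj B).
by have [c ->] := to_red_surj C; rewrite -!to_redM mulgA.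
Qed.

Lemma red_mul1 : left_id (to_red 1) red_mul.
Proof. by move=> A; have [a ->] := to_red_surj A; rewrite -to_redM mul1g. Qed.

Lemma red_mul1r : right_id (to_red 1) red_mul.
Proof. by move=> A; rewrite red_mulC red_mul1. Qed.

Lemma red_mulI : right_injective red_mul.
Proof.
move=> A B C; have [[a ->] [b ->]] := (to_red_surj A, to_red_surj B).
have [c ->] := to_red_surj C; rewrite -!to_redM => /to_redP[e ue].
by rewrite -mulgA => /mulgI ->; apply/to_redP; exists e.
Qed.

HB.instance Definition _ := isMonoid.Build red red_mulA red_mul1 red_mul1r.
HB.instance Definition _ :=
  Monoid_isCancelComMonoid.Build red red_mulC red_mulI.

End Arithmetic.

Arguments units M : clear implicits.
Arguments atoms M : clear implicits.

Notation factorizations S := {mset (atoms (red S))}.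

Section Factorizations.
Variable S : ccmonoidType.
Implicit Types (a : S) (x y z : factorizations S).

Definition fpi z : red S := \prod_(u <- z) val u.

Lemma fpiM : {morph fpi : x y / x * y}.
Proof.
move=> x y; rewrite /fpi -big_cat; apply: perm_big.
by apply/allP => u _ /=; rewrite count_cat !count_mem_mset msetE2.
Qed.

Lemma fpi1 : fpi 1 = 1. Proof. exact: big_mset0. Qed.

Lemma fpi_atom u : fpi [mset u] = val u.
Proof. by rewrite /fpi enum_msetn big_seq1. Qed.

Definition fZ a : set (factorizations S) := [set z | fpi z = to_red a].

Definition flen z : nat := size z.

Definition fL a : set nat := [set flen z | z in fZ a].

Definition atomic : Prop := forall a, fZ a !=set0.

Definition fideal x : set (factorizations S) := range (fun z => x * z).

Definition rel_set : set (factorizations S * factorizations S) := [set p | fpi p.1 = fpi p.2].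

Lemma rel_set_closed : monoid_closed (fun p => p \in rel_set).
Proof.
split=> [|p q]; first exact/mem_set.
move=> /set_mem pE /set_mem qE; apply/mem_set.
by rewrite /rel_set /= !fpiM pE qE.
Qed.

Definition relmon : Type := rel_set.
HB.instance Definition _ := SubChoice.on relmon.
HB.instance Definition _ := SubChoice_isSubMonoid.Build _ _ relmon rel_set_closed.

Lemma relmon_mulC : commutative (@mul relmon).
Proof. by move=> p q; apply: val_inj; rewrite !valM mulgC. Qed.

Lemma relmon_mulI : right_injective (@mul relmon).
Proof.
move=> p q r /(congr1 val); rewrite !valM => /mulgI.
exact: val_inj.
Qed.

HB.instance Definition _ := Monoid_isCancelComMonoid.Build relmon
  relmon_mulC relmon_mulI.

End Factorizations.

Arguments atomic S : clear implicits.
Arguments relmon S : clear implicits.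

Section Invariants.
Variable S : ccmonoidType.
Implicit Types (a : S) (x y z : factorizations S).

Definition rel_length : enat :=
  esup [set Fin (flen (val p).1) | p in atoms (relmon S)].

(** On multisets, [`&`] is the gcd and [`\`] the quotient by a divisor. *)
Definition fdist z z' : nat :=
  maxn (flen (z `\` (z `&` z'))%mset) (flen (z' `\` (z `&` z'))%mset).

Definition fset_dist (X Y : set (factorizations S)) : enat :=
  einf [set Fin (fdist x y) | x in X & y in Y].

(** The set below contains [Infty], so [einf] is its smallest element. *)
Definition tame_degree_elt a x : enat :=
  einf [set N | fZ a `&` fideal x !=set0 -> forall z, fZ a z ->
    exists2 z', (fZ a `&` fideal x) z' & (Fin (fdist z z') <= N)%O].

Definition tame_degree_at x : enat :=
  esup (range (fun a => tame_degree_elt a x)).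

Definition tame_degree : enat :=
  esup [set tame_degree_at [mset u] | u in [set: atoms (red S)]].

Definition adjacent (L : set nat) (k l : nat) : Prop :=
  [/\ L k, L l, k <> l &
      forall m, L m -> ~ ((k < m < l)%N || (l < m < k)%N)].

Definition fZ_len a (k : nat) : set (factorizations S) :=
  [set z | fZ a z /\ flen z = k].

(** For adjacent lengths both sets [fZ_len a _] are nonempty, so the default
    value of [einf] in [fset_dist] plays no role. *)
Definition cadj_elt a : enat :=
  esup [set d | exists k l, adjacent (fL a) k l /\
                            d = fset_dist (fZ_len a k) (fZ_len a l)].

Definition cadj : enat := esup (range cadj_elt).

End Invariants.

Arguments rel_length S : clear implicits.
Arguments tame_degree S : clear implicits.
Arguments cadj S : clear implicits.

(* Main.v *)
(** Factor a pair of factorizations [(z'', z)] of the same element into atoms of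
    the monoid of relations. For the tame degree, one of these atoms [(x, y)]
    has [u] dividing [x]; replacing [y] by [x] inside [z] moves [z] by at
    most [max(|x|, |y|)].
    For adjacent lengths [k < l], the length differences [|y_i| - |x_i|] of the
    atoms are bounded by [A], the bound on the lengths of atoms, and sum to
    [l - k]; by adjacency a single exchange with positive difference already
    jumps over the whole gap, so [l - k <= A]. A sequence of integers in
    [[-A, A]] with sum in [[-A, A]] has a subsequence of length at most [2A]
    with the same sum, and exchanging only these atoms costs at most [2A * A]. *)
Require Import Defs.
From mathcomp Require Import all_boot all_order finmap multiset.
From mathcomp Require Import ssralg ssrnum ssrint zify.
From mathcomp Require Import boolp classical_sets.

Set Implicit Arguments.
Unset Strict Implicit.
Unset Printing Implicit Defensive.

Local Open Scope mset_scope.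
Local Open Scope classical_set_scope.

(** * Zero-sum blocks in integer sequences *)

Section BalancedSublist.
Variables (T : eqType) (f : T -> int) (A : nat).
Local Open Scope ring_scope.
Import GRing.Theory Num.Theory.

(* Greedily take a term whose sign is opposite to that of the current sum. *)
Lemma perm_bounded_partial_sums (s : seq T) (c : int) :
  {in s, forall x, `|f x| <= A%:Z} -> `|c| <= A%:Z ->
  `|c + \sum_(x <- s) f x| <= A%:Z ->
  exists2 s', perm_eq s s' &
    forall i, `|c + \sum_(x <- take i s') f x| <= A%:Z.
Proof.
move: {2}(size s) (erefl (size s)) => n.
(* The offset [c] stands for the sum of the terms already placed. *)
elim: n s c => [|n IHn] s c.
  by move=> /size0nil -> _ cA _; exists [::] => // i; rewrite big_nil addr0.
move=> sz_s fA cA sA.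
have [x xs cxA]: exists2 x, x \in s & `|c + f x| <= A%:Z.
  have [c0|c0] := lerP c 0.
    have [/hasP[x xs fx]|/hasPn sneg] := boolP (has (fun x => 0 <= f x) s).
      by exists x => //; have := fA x xs; lia.
    (* All terms are negative, so any of them will do: [c + f x] is at least the total sum, hence at
       least [-A]. *)
    case: s sz_s fA sA sneg => // x s _ fA; rewrite big_cons => sA sneg.
    exists x; first by rewrite mem_head.
    have: \sum_(y <- s) f y <= 0.
      rewrite big_seq; apply: sumr_le0 => y ys.
      by have := sneg y; rewrite inE ys orbT => /(_ isT); lia.
    move: sA (sneg x (mem_head _ _)) (fA x (mem_head _ _)).
    by move: (\sum_(y <- s) f y) => t; lia.
  have [/hasP[x xs fx]|/hasPn spos] := boolP (has (fun x => f x <= 0) s).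
    by exists x => //; have := fA x xs; lia.
  case: s sz_s fA sA spos => // x s _ fA; rewrite big_cons => sA spos.
  exists x; first by rewrite mem_head.
  have: 0 <= \sum_(y <- s) f y.
    rewrite big_seq; apply: sumr_ge0 => y ys.
    by have := spos y; rewrite inE ys orbT => /(_ isT); lia.
  move: sA (spos x (mem_head _ _)) (fA x (mem_head _ _)).
  by move: (\sum_(y <- s) f y) => t; lia.
have s_rem := perm_to_rem xs.
case: (IHn (rem x s) (c + f x)) => //.
- by rewrite size_rem // sz_s.
- by move=> y /mem_rem/fA.
- by rewrite -addrA -(big_cons _ _ x _ xpredT) -(perm_big _ s_rem).
move=> s' ss' s'A; exists (x :: s').
  by rewrite (perm_trans s_rem) // perm_cons.
case=> [|i]; first by rewrite big_nil addr0.
by rewrite /= big_cons addrA.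
Qed.

(* Two equal partial sums of a bounded rearrangement delimit a zero-sum block. *)
Lemma zero_sum_sublist (s : seq T) :
  {in s, forall x, `|f x| <= A%:Z} -> `|\sum_(x <- s) f x| <= A%:Z ->
  (A.*2 < size s)%N ->
  exists s1 s2, [/\ perm_eq s (s1 ++ s2), (0 < size s2)%N &
                    \sum_(x <- s2) f x = 0].
Proof.
move=> fA sA sz_s.
have [||s' ss' s'A] := perm_bounded_partial_sums (c := 0) fA; rewrite ?add0r //.
(* Pigeonhole: shifted by [A], the partial sums lie in [0..2A], so [absz] loses nothing. With the
   empty prefix there are [size s + 1] of them, more than the [2A + 1] values. *)
pose g i := absz (\sum_(x <- take i s') f x + A%:Z).
have ps i : `|\sum_(x <- take i s') f x| <= A%:Z.
  by have := s'A i; rewrite add0r.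
have: ~~ uniq [seq g i | i <- iota 0 (size s).+1].
  apply/negP => /uniq_leq_size le_size.
  have /le_size : {subset [seq g i | i <- iota 0 (size s).+1] <= iota 0 A.*2.+1}.
    by move=> _ /mapP[i _ ->]; rewrite mem_iota /g; have := ps i; lia.
  by rewrite size_map !size_iota; lia.
case/(uniqPn 0%N) => i [j []]; rewrite size_map size_iota => ij js.
rewrite !(nth_map 0%N) ?size_iota //; last by lia.
rewrite !nth_iota // ?add0n; last by lia.
rewrite /g => eq_g.
have take_j : take j s' = take i s' ++ take (j - i) (drop i s').
  by rewrite -takeD subnKC // ltnW.
exists (take i s' ++ drop (j - i) (drop i s')), (take (j - i) (drop i s')).
split.
- rewrite (perm_trans ss') // -{1}(cat_take_drop i s').
  rewrite -{1}(cat_take_drop (j - i) (drop i s')) -!catA perm_cat2l.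
  exact: permEl (perm_catC _ _).
- by rewrite size_take_min size_drop -(perm_size ss'); lia.
- have := ps i; have := ps j; move: eq_g; rewrite take_j big_cat /=.
  move: (\sum_(x <- take i s') f x) => b.
  by move: (\sum_(x <- take (j - i) (drop i s')) f x) => c; lia.
Qed.

(** As long as more than [2A] terms remain, a zero-sum block can be cut out without changing the
    sum. *)
Lemma bounded_sublist_same_sum (s : seq T) :
  {in s, forall x, `|f x| <= A%:Z} -> `|\sum_(x <- s) f x| <= A%:Z ->
  exists s1 s2, [/\ perm_eq s (s1 ++ s2), (size s1 <= A.*2)%N &
                    \sum_(x <- s1) f x = \sum_(x <- s) f x].
Proof.
have [n] := ubnP (size s); elim: n s => // n IHn s s_n fA sA.
have [sz_s|sz_s] := leqP (size s) A.*2.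
  by exists s, [::]; rewrite cats0.
have [s1 [s2 [ps sz2 sum2]]] := zero_sum_sublist fA sA sz_s.
have sum1 : \sum_(x <- s1) f x = \sum_(x <- s) f x.
  by rewrite (perm_big _ ps) big_cat /= sum2 addr0.
case: (IHn s1).
- by move: s_n; rewrite (perm_size ps) size_cat; lia.
- by move=> x xs1; apply: fA; rewrite (perm_mem ps) mem_cat xs1.
- by rewrite sum1.
move=> t1 [t2 [pt szt sumt]]; exists t1, (t2 ++ s2); split=> //.
  by rewrite (perm_trans ps) // catA perm_cat2r.
by rewrite sumt.
Qed.

End BalancedSublist.

(** * Lengths and distances of factorizations *)

Section Relations.
Variable S : ccmonoidType.
Implicit Types (x y z w : factorizations S) (p q r : relmon S).
Local Open Scope group_scope.

Lemma flenM x y : flen (x * y) = (flen x + flen y)%N.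
Proof.
rewrite /flen -size_cat; apply: perm_size.
by apply/allP => u _ /=; rewrite count_cat !count_mem_mset msetE2.
Qed.

Lemma flen_eq0 x : flen x = 0 -> x = 1.
Proof. by move=> /eqP; rewrite /flen size_mset_eq0 => /eqP. Qed.

Lemma flen1 : flen (1 : factorizations S) = 0.
Proof. exact: size_mset0. Qed.

Lemma msubset_flen x y : (x `<=` y)%mset -> (flen x <= flen y)%N.
Proof. by move=> /msetBDKC <-; rewrite (flenM x) leq_addr. Qed.

(** The common factor [w] divides the gcd, so what is left of each side divides [x] or [y]. *)
Lemma fdist_mulr x y w :
  (fdist (x * w)%g (y * w)%g <= maxn (flen x) (flen y))%N.
Proof.
have sub v v' : ((v * w)%g `\` ((v * w)%g `&` (v' * w)%g) `<=` v)%mset.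
  by apply/msubsetP => u; rewrite !msetE2; lia.
rewrite /fdist geq_max !leq_max.
by rewrite (msubset_flen (sub x y)) msetIC (msubset_flen (sub y x)) orbT.
Qed.

Lemma fdistC x y : fdist x y = fdist y x.
Proof. by rewrite /fdist msetIC maxnC. Qed.

Lemma fideal1P (u : atoms (red S)) z : fideal [mset u] z <-> u \in z.
Proof.
split=> [[w _ <-]|uz]; first exact: mset1D1.
by exists (z `\ u)%mset => //; apply: msetB1K.
Qed.

(** * The monoid of relations and its atoms *)

Lemma relP p : fpi (val p).1 = fpi (val p).2.
Proof. exact: set_mem (valP p). Qed.

Definition mk_rel x y (xy : fpi x = fpi y) : relmon S :=
  exist _ (x, y) (mem_set (xy : rel_set (x, y))).

Definition rel_swap p : relmon S := mk_rel (esym (relP p)).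

Lemma rel_swapM p q : rel_swap (p * q) = rel_swap p * rel_swap q.
Proof. exact: val_inj. Qed.

Lemma rel_swapK p : rel_swap (rel_swap p) = p.
Proof. by apply: val_inj; case: p => -[]. Qed.

(** Additive and zero only at 1: this makes the monoid of relations reduced and serves as induction
    measure. *)
Definition rel_size p : nat := flen (val p).1 + flen (val p).2.

Lemma rel_sizeM p q : rel_size (p * q) = (rel_size p + rel_size q)%N.
Proof. by rewrite /rel_size !flenM addnACA. Qed.

Lemma rel_size_eq0 p : rel_size p = 0 -> p = 1.
Proof.
rewrite /rel_size => p0; apply: val_inj; rewrite [LHS]surjective_pairing.
by congr pair; apply: flen_eq0; lia.
Qed.

Lemma rel_unit1 p : units (relmon S) p -> p = 1.
Proof.
move=> [q pq]; apply: rel_size_eq0.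
have := congr1 rel_size pq; rewrite rel_sizeM {3}/rel_size !flen1; lia.
Qed.

Lemma rel_swap_unit p : units (relmon S) (rel_swap p) -> units (relmon S) p.
Proof.
move=> [q pq]; exists (rel_swap q).
by rewrite -[p]rel_swapK -rel_swapM pq; exact: val_inj.
Qed.

(** [rel_length] looks at first components only; by this symmetry it bounds the second components as
    well. *)
Lemma rel_swap_atom p : atoms (relmon S) p -> atoms (relmon S) (rel_swap p).
Proof.
move=> [pu pirr]; split=> [/rel_swap_unit//|q r pqr].
have [] : units (relmon S) (rel_swap q) \/ units (relmon S) (rel_swap r).
- by apply: pirr; rewrite -rel_swapM -pqr rel_swapK.
- by move=> /rel_swap_unit; left.
- by move=> /rel_swap_unit; right.
Qed.

(** A relation that is neither a unit nor an atom splits into two nonunits, both of smaller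
    [rel_size]. *)
Lemma rel_atomic p :
  exists2 s : seq (relmon S),
    {in s, forall q, atoms (relmon S) q} & p = \prod_(q <- s) q.
Proof.
have [n] := ubnP (rel_size p); elim: n p => // n IHn p p_n.
have [p1|pu] := pselect (units (relmon S) p).
  by exists [::]; rewrite ?big_nil //; apply: rel_unit1.
have [pa|pna] := pselect (atoms (relmon S) p).
  by exists [:: p]; rewrite ?big_seq1 // => q; rewrite inE => /eqP ->.
have [q [r [pqr qu ru]]] : exists q r,
    [/\ p = q * r, ~ units (relmon S) q & ~ units (relmon S) r].
  apply: contrapT => nqr; apply: pna; split=> // q r pqr.
  apply: contrapT => /not_orP[qu ru].
  by apply: nqr; exists q, r.
have size_gt0 t : ~ units (relmon S) t -> (0 < rel_size t)%N.
  move=> tu; rewrite lt0n; apply/eqP => /rel_size_eq0 t1.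
  by apply: tu; rewrite t1; apply: units1.
move: p_n (size_gt0 q qu) (size_gt0 r ru); rewrite pqr rel_sizeM => p_n q0 r0.
have [|s sa ->] := IHn q; first by lia.
have [|t ta ->] := IHn r; first by lia.
exists (s ++ t); last by rewrite big_cat.
by move=> v; rewrite mem_cat => /orP[/sa|/ta].
Qed.

Lemma mem_rel_prod1 (u : atoms (red S)) (s : seq (relmon S)) :
  u \in (val (\prod_(q <- s) q)).1 -> exists2 q, q \in s & u \in (val q).1.
Proof.
elim: s => [|q s IHs]; first by rewrite big_nil [_ \in _]in_mset0.
rewrite big_cons => /msetDP[uq|/IHs[r rs ur]].
  by exists q; rewrite ?mem_head.
by exists r; rewrite ?inE ?rs ?orbT.
Qed.

Lemma fZ_exchange (a : S) p q :
  fZ a (val (p * q)).1 -> fZ a ((val p).2 * (val q).1).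
Proof. by rewrite /fZ /= !fpiM relP. Qed.

(** Common source of both tame degree bounds; [N] may be infinite because the suprema put in its
    place may be. *)
Lemma tame_degree_at_le (u : atoms (red S)) (N : enat) :
  (forall p, atoms (relmon S) p -> u \in (val p).1 ->
     (Fin (flen (val p).1) <= N)%O /\ (Fin (flen (val p).2) <= N)%O) ->
  (tame_degree_at [mset u] <= N)%O.
Proof.
move=> atomN; apply: esup_le => _ [a _ <-].
(* [Infty] lies in the set defining the tame degree, so its infimum is a lower bound and it suffices
   that [N] belongs to the set. *)
apply: (proj2 (einf_least _)).
  by exists Infty => -[z0 z0u] z _; exists z0; rewrite ?leeInfty.
move=> [z0 [z0a /fideal1P uz0]] z za.
have [s sa p_prod] := rel_atomic (mk_rel (etrans z0a (esym za))).
have [|q qs uq] := @mem_rel_prod1 u s; first by rewrite -p_prod; apply: uz0.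
move: p_prod; rewrite (perm_big _ (perm_to_rem qs)) big_cons.
set w := \prod_(_ <- _) _ => p_prod.
have z0E : z0 = (val q).1 * (val w).1.
  by have /(congr1 (fun p => (val p).1)) := p_prod.
have -> : z = (val q).2 * (val w).2.
  by have /(congr1 (fun p => (val p).2)) := p_prod.
exists ((val q).1 * (val w).2).
  split; last by apply/fideal1P/msetDP; left.
  by rewrite /fZ /= fpiM -relP -fpiM -z0E.
apply: Order.POrderTheory.le_trans (_ : (Fin _ <= Fin _)%O) _.
  exact: fdist_mulr.
by have [] := atomN q (sa q qs) uq; case: N {atomN} => //= n;
  rewrite !lee_fin geq_max => -> ->.
Qed.

(** * Length differences and adjacent lengths *)

Definition rel_diff p : int := ((flen (val p).2)%:Z - (flen (val p).1)%:Z)%R.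

Lemma rel_diffM p q : rel_diff (p * q) = (rel_diff p + rel_diff q)%R.
Proof. by rewrite /rel_diff !flenM !PoszD GRing.opprD GRing.addrACA. Qed.

Lemma rel_diff_prod (s : seq (relmon S)) :
  rel_diff (\prod_(q <- s) q) = (\sum_(q <- s) rel_diff q)%R.
Proof.
apply: (big_morph rel_diff rel_diffM).
by rewrite /rel_diff !flen1.
Qed.

Lemma flen_prod_le (A : nat) (s : seq (relmon S)) :
  {in s, forall q, (flen (val q).1 <= A)%N /\ (flen (val q).2 <= A)%N} ->
  (maxn (flen (val (\prod_(q <- s) q)%g).1) (flen (val (\prod_(q <- s) q)%g).2)
   <= size s * A)%N.
Proof.
elim: s => [|q s IHs] sA; first by rewrite !big_nil !flen1.
rewrite big_cons !flenM geq_max mulSn.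
have [q1 q2] := sA q (mem_head _ _).
have := IHs (fun r rs => sA r (mem_behead (s := q :: s) rs)).
by rewrite geq_max => /andP[s1 s2]; rewrite !leq_add.
Qed.

Lemma fset_dist_le (X Y : set (factorizations S)) x y :
  X x -> Y y -> (fset_dist X Y <= Fin (fdist x y))%O.
Proof.
move=> Xx Yy; have XY : [set Fin (fdist x y) | x in X & y in Y] (Fin (fdist x y)).
  by exists x => //; exists y.
by apply: (proj2 (einf_least _)) => //; exists (Fin (fdist x y)).
Qed.

Lemma adjacent_dist (A : nat) (a : S) (k l : nat) :
  (forall p, atoms (relmon S) p ->
     (flen (val p).1 <= A)%N /\ (flen (val p).2 <= A)%N) ->
  adjacent (fL a) k l -> (k < l)%N ->
  exists z z', [/\ fZ_len a k z, fZ_len a l z' & (fdist z z' <= A.*2 * A)%N].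
Proof.
move=> atomA [[z za zk] [z' z'a z'l] _ gap] lt_kl.
have [s sa p_prod] := rel_atomic (mk_rel (etrans za (esym z'a))).
have sum_s : (\sum_(q <- s) rel_diff q)%R = (l%:Z - k%:Z)%R.
  by rewrite -rel_diff_prod -p_prod /rel_diff /= zk z'l.
(* Exchanging any subproduct [q] gives a new factorization of [a]. This is used first for one atom,
   then for a whole sublist. *)
have split_z q (w : relmon S) : \prod_(r <- s) r = q * w ->
    [/\ z = (val q).1 * (val w).1, fZ a ((val q).2 * (val w).1) &
        Posz (flen ((val q).2 * (val w).1)) = (k%:Z + rel_diff q)%R].
  rewrite -p_prod => qw; have z_qw : z = (val q).1 * (val w).1.
    by have /(congr1 (fun p => (val p).1)) := qw.
  split=> //; first by apply: fZ_exchange; rewrite -qw.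
  by rewrite -zk z_qw /rel_diff !flenM; lia.
have diffA q : q \in s -> (`|rel_diff q| <= A%:Z)%R.
  by move=> /sa/atomA; rewrite /rel_diff; lia.
have sumA : (`|\sum_(q <- s) rel_diff q| <= A%:Z)%R.
  have [/hasP[q qs q0]|/hasPn neg] := boolP (has (fun q => 0 < rel_diff q)%R s).
    have [|_ ma m_len] := split_z q (\prod_(r <- rem q s) r).
      by rewrite (perm_big _ (perm_to_rem qs)) big_cons.
    (* The new length exceeds [k], so by adjacency it is at least [l]; thus [l - k] is at most
       [rel_diff q]. *)
    have := gap _ (imageP (@flen S) ma).
    by rewrite sum_s; have := diffA q qs; lia.
  (* Without a positive difference the sum could not equal [l - k > 0]. *)
  have : (\sum_(q <- s) rel_diff q <= 0)%R.
    rewrite big_seq; apply: Num.Theory.sumr_le0 => q /neg.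
    by rewrite Order.TotalTheory.ltNge negbK.
  by rewrite sum_s; lia.
have [s1 [s2 [ps s1A sum1]]] := bounded_sublist_same_sum diffA sumA.
have [|z_eq ma m_len] := split_z (\prod_(r <- s1) r) (\prod_(r <- s2) r).
  by rewrite (perm_big _ ps) big_cat.
exists z, ((val (\prod_(r <- s1) r)).2 * (val (\prod_(r <- s2) r)).1).
split=> //.
  split=> //; move: m_len.
  by rewrite rel_diff_prod sum1 sum_s GRing.addrC GRing.subrK => -[].
(* Both factorizations share the first component of the product over [s2]; they differ only by the
   exchange of the at most [2A] atoms in [s1]. *)
rewrite {1}z_eq (leq_trans (fdist_mulr _ _ _)) //.
rewrite (leq_trans (flen_prod_le (A := A) _)) ?leq_mul2r ?s1A ?orbT //.
by move=> q qs1; apply/atomA/sa; rewrite (perm_mem ps) mem_cat qs1.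
Qed.

End Relations.

Theorem proposition5p2 (S : ccmonoidType) (S_atomic : atomic S) :
  [/\ forall u : atoms (red S),
        (tame_degree_at [mset u] <=
         esup [set n | exists2 p : relmon S, atoms (relmon S) p &
                 fideal [mset u] (val p).1 /\
                 (n = Fin (flen (val p).1) \/ n = Fin (flen (val p).2))])%O,
      (tame_degree S <= rel_length S)%O &
      (rel_length S < Infty)%O -> (cadj S < Infty)%O].
Proof.
have len_le (p : relmon S) : atoms (relmon S) p ->
    (Fin (flen (val p).1) <= rel_length S)%O /\
    (Fin (flen (val p).2) <= rel_length S)%O.
  move=> pa; split; apply: esup_ubound; first by exists p.
  by exists (rel_swap p) => //; apply: rel_swap_atom.
split=> [u||].
- apply: tame_degree_at_le => p pa up.
  by split; apply: esup_ubound; exists p => //; split;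
    [apply/fideal1P | left | apply/fideal1P | right].
- apply: esup_le => _ [u _ <-].
  by apply: tame_degree_at_le => p pa _; apply: len_le.
- move=> /lteInfty[A relA]; apply/lteInfty.
  have lenA (p : relmon S) : atoms (relmon S) p ->
      (flen (val p).1 <= A)%N /\ (flen (val p).2 <= A)%N.
    by move=> /len_le; rewrite relA.
  suff: (cadj S <= Fin (A.*2 * A))%O by case: cadj => // n _; exists n.
  apply: esup_le => _ [a _ <-]; apply: esup_le => _ [k [l [kl ->]]].
  have [_ _ /eqP + _] := kl; rewrite neq_ltn => /orP[lt_kl|lt_lk].
    have [z [z' [zk z'l dA]]] := adjacent_dist lenA kl lt_kl.
    apply: Order.POrderTheory.le_trans (fset_dist_le zk z'l) _; exact: dA.
  (* Adjacency and distance are symmetric, which reduces [l < k] to the previous case. *)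
  have lk : adjacent (fL a) l k.
    case: kl => Lk Ll kl nm; split=> // [/esym//|m /nm].
    by rewrite orbC.
  have [z [z' [zl z'k dA]]] := adjacent_dist lenA lk lt_lk.
  rewrite fdistC in dA.
  apply: Order.POrderTheory.le_trans (fset_dist_le z'k zl) _; exact: dA.
Qed.
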